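(* Let $F$ be a field. 1. If $\operatorname{char}(F)\neq2$, then a mixed Dedekind Poisson algebra over $F$ exists if and only if $F$ has a non-square. 2. If $\operatorname{char}(F)=2$, then a mixed Dedekind Poisson algebra over $F$ exists if and only if $F$ is imperfect.
   Context: A Poisson algebra over a field $F$ is an $F$-vector space $P$ with a bilinear commutative associative multiplication $xy$ (no identity element is assumed) and an alternating Lie bracket $[\,,\,]$ ($[x,x]=0$ for all $x$, also in characteristic $2$) satisfying $[xy,z]=x[y,z]+y[x,z]$. A Poisson subalgebra is a subspace closed under both operations; a Poisson ideal is a subspace $I$ with $PI\subseteq I$ and $[P,I]\subseteq I$. A Poisson algebra is Dedekind if every Poisson subalgebra is a Poisson ideal. No finite-dimensionality is assumed. A Poisson algebra $P$ is mixed if both of its multiplications are non-zero, i.e. $P^2\neq0$ and $[P,P]\neq0$, where $P^2$ and $[P,P]$ are the linear spans of all products $xy$ and all brackets $[x,y]$ respectively. An element $a\in F^\times$ is a square if $a=b^2$ for some $b\in F^\times$, and a non-square otherwise. A field $F$ of characteristic $2$ is perfect if $x\mapsto x^2$ is surjective on $F$, and imperfect otherwise. *)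

(* Defs.v *)
From HB Require Import structures.
From mathcomp Require Import all_boot all_algebra.
From mathcomp Require Import boolp classical_sets.

Set Implicit Arguments.
Unset Strict Implicit.
Unset Printing Implicit Defensive.

Import GRing.Theory.
Local Open Scope classical_set_scope.
Local Open Scope ring_scope.

(* The commutative product [pmul] has no unit, so it cannot be the ring product
   of the algebraic hierarchy. *)
HB.mixin Record Lmodule_isPoisson (F : fieldType) P of GRing.Lmodule F P := {
  pmul : P -> P -> P;
  pbracket : P -> P -> P;
  pmul_bilinear : bilinear_for *:%R *:%R pmul;
  pmulC : commutative pmul;
  pmulA : associative pmul;
  pbracket_bilinear : bilinear_for *:%R *:%R pbracket;
  pbracketxx : forall x, pbracket x x = 0;
  pbracket_jacobi : forall x y z,
    pbracket x (pbracket y z) + pbracket y (pbracket z x)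
      + pbracket z (pbracket x y) = 0;
  pbracket_leibniz : forall x y z,
    pbracket (pmul x y) z = pmul x (pbracket y z) + pmul y (pbracket x z)
}.

#[short(type="poissonType")]
HB.structure Definition Poisson (F : fieldType) :=
  { P of GRing.Lmodule F P & Lmodule_isPoisson F P }.

Section PoissonTheory.
Variables (F : fieldType) (P : poissonType F).
Implicit Types S I : set P.

Definition subspace S := submod_closed (mem S).

Definition poisson_subalgebra S :=
  [/\ subspace S,
      forall x y, S x -> S y -> S (pmul x y)
    & forall x y, S x -> S y -> S (pbracket x y)].

Definition poisson_ideal I :=
  [/\ subspace I,
      forall p x, I x -> I (pmul p x)
    & forall p x, I x -> I (pbracket p x)].

Definition dedekind := forall S, poisson_subalgebra S -> poisson_ideal S.

Definition linear_span S : set P := smallest subspace S.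

Definition mixed :=
  linear_span [set pmul x y | x in setT & y in setT] <> [set 0] /\
  linear_span [set pbracket x y | x in setT & y in setT] <> [set 0].

End PoissonTheory.

Arguments dedekind {F} P.
Arguments mixed {F} P.

Definition nonsquare (F : fieldType) (a : F) :=
  a != 0 /\ ~ (exists b : F, b != 0 /\ a = b ^+ 2).

(* Perfectness in this form is only meant for fields of characteristic 2. *)
Definition perfect2 (F : fieldType) := forall a : F, exists b : F, b ^+ 2 = a.

Definition imperfect2 (F : fieldType) := ~ perfect2 F.

(* Main.v *)
Require Import Defs.
From HB Require Import structures.
From mathcomp Require Import all_boot all_algebra.
From mathcomp Require Import boolp classical_sets.
From mathcomp Require Import ring.

Set Implicit Arguments.
Unset Strict Implicit.
Unset Printing Implicit Defensive.

Import GRing.Theory.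
Local Open Scope ring_scope.

(** Whatever the characteristic, a mixed Dedekind algebra over [F] exists exactly
    when [F] has an element that is not a square; zero being a square, this is
    the non-square condition away from characteristic 2 and imperfection in
    characteristic 2.

    Existence. If [c] is not a square, the binary form [s^2 - c t^2] is
    anisotropic. On the space with basis [p], [x], [u] put [p p = u],
    [x x = - c u], [p x = 0], [[p, x] = u], with [u] killed by everything. All
    products and brackets lie on the line of [u], and by anisotropy every
    subspace closed under products contains [u] or is contained in its line;
    either way it is an ideal ([aniso_dedekind]).

    Non-existence. In a Dedekind algebra the subalgebra attached to an element
    absorbs products and brackets with that element. For [x ^ 2] in place of the
    element this yields an idempotent [e] with [x ^ 3 e = x ^ 3]
    ([cube_absorbs_idempotent]). Idempotents are central for the bracket and
    there is at most one that is non-zero, so up to a central line every element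
    is annihilated by that idempotent and has zero cube
    ([idempotent_nil_complement]). Among such elements [p x] and [[p, x]] lie on
    the line of [x ^ 2] ([nil_square_line]), and symmetrically on that of
    [p ^ 2]. If [u = [p, x]] is non-zero, then [p p = A u], [p x = B u] and
    [x x = C u], and a square root of [B^2 - A C] provides a combination [q] of
    [p] and [x], with a non-zero component on [x], whose square is zero. Then
    [[p, q]] lies on the line of [q ^ 2 = 0], whereas it is a non-zero multiple
    of [u] ([dedekind_abelian]). Thus a Dedekind algebra over a field in which
    all elements are squares has zero bracket, and is not mixed. *)

Local Notation "x ** y" := (pmul x y) (at level 40, left associativity).
Local Notation "⟦ x , y ⟧" := (pbracket x y) (at level 0).

(** * Calculus in a Poisson algebra *)

Section Calculus.
Variables (F : fieldType) (P : poissonType F).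
Implicit Types (x y z : P) (a : F) (S : set P).

Lemma pmulZDr x a y z : x ** (a *: y + z) = a *: (x ** y) + x ** z.
Proof. by have [_ h] := @pmul_bilinear F P; rewrite (h x). Qed.

Lemma pmulDr x y z : x ** (y + z) = x ** y + x ** z.
Proof. by have := pmulZDr x 1 y z; rewrite !scale1r. Qed.

Lemma pmul0r x : x ** 0 = 0.
Proof. by apply: (addrI (x ** 0)); rewrite -pmulDr !addr0. Qed.

Lemma pmulZr x a y : x ** (a *: y) = a *: (x ** y).
Proof. by have := pmulZDr x a y 0; rewrite pmul0r !addr0. Qed.

Lemma pmulDl x y z : (y + z) ** x = y ** x + z ** x.
Proof. by rewrite !(pmulC _ x) pmulDr. Qed.

Lemma pmulZl x a y : (a *: y) ** x = a *: (y ** x).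
Proof. by rewrite !(pmulC _ x) pmulZr. Qed.

Lemma pmul0l x : 0 ** x = 0.
Proof. by rewrite pmulC pmul0r. Qed.

Lemma pmulNr x y : x ** (- y) = - (x ** y).
Proof. by rewrite -scaleN1r pmulZr scaleN1r. Qed.

Lemma pmulCA x y z : x ** (y ** z) = y ** (x ** z).
Proof. by rewrite !pmulA (pmulC x). Qed.

Lemma pbracketZDr x a y z : ⟦x, a *: y + z⟧ = a *: ⟦x, y⟧ + ⟦x, z⟧.
Proof. by have [_ h] := @pbracket_bilinear F P; rewrite (h x). Qed.

Lemma pbracketZDl x a y z : ⟦a *: y + z, x⟧ = a *: ⟦y, x⟧ + ⟦z, x⟧.
Proof. by have [h _] := @pbracket_bilinear F P; rewrite (h x). Qed.

Lemma pbracketDr x y z : ⟦x, y + z⟧ = ⟦x, y⟧ + ⟦x, z⟧.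
Proof. by have := pbracketZDr x 1 y z; rewrite !scale1r. Qed.

Lemma pbracketDl x y z : ⟦y + z, x⟧ = ⟦y, x⟧ + ⟦z, x⟧.
Proof. by have := pbracketZDl x 1 y z; rewrite !scale1r. Qed.

Lemma pbracket0r x : ⟦x, 0⟧ = 0.
Proof. by apply: (addrI ⟦x, 0⟧); rewrite -pbracketDr !addr0. Qed.

Lemma pbracketZr x a y : ⟦x, a *: y⟧ = a *: ⟦x, y⟧.
Proof. by have := pbracketZDr x a y 0; rewrite pbracket0r !addr0. Qed.

Lemma pbracketC x y : ⟦x, y⟧ = - ⟦y, x⟧.
Proof.
have := pbracketxx (x + y).
rewrite pbracketDl !pbracketDr !pbracketxx add0r addr0 => /eqP.
by rewrite addr_eq0 => /eqP.
Qed.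

Lemma pbracketZl x a y : ⟦a *: y, x⟧ = a *: ⟦y, x⟧.
Proof. by rewrite pbracketC pbracketZr -scalerN -pbracketC. Qed.

Lemma pbracketMr x y z : ⟦x, y ** z⟧ = y ** ⟦x, z⟧ + z ** ⟦x, y⟧.
Proof.
by rewrite pbracketC pbracket_leibniz opprD -!pmulNr -!(pbracketC x).
Qed.

Lemma subspaceP S :
  subspace S <-> S 0 /\ forall a x y, S x -> S y -> S (a *: x + y).
Proof.
split=> -[S0 SD]; split; first by rewrite -[S 0]/(S 0) -in_setE.
- by move=> a x y /mem_set Sx /mem_set Sy; apply/set_mem; apply: SD.
- by rewrite in_setE.
- by move=> a x y /set_mem Sx /set_mem Sy; apply/mem_set; apply: SD.
Qed.

Lemma subspace_pred0 : subspace [set (0 : P)]%classic.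
Proof. by apply/subspaceP; split=> // a x y -> ->; rewrite scaler0 addr0. Qed.

Lemma linear_span_eq0 (A : set P) :
  linear_span A = [set 0]%classic <-> (A `<=` [set 0])%classic.
Proof.
split=> [<- x Ax B [_]|A0]; first exact.
apply/seteqP; split=> [x|_ -> B [/subspaceP [B0 _] _] //].
by apply; split=> //; exact: subspace_pred0.
Qed.

Lemma mixedP :
  mixed P <-> (exists x y : P, x ** y <> 0) /\ (exists x y : P, ⟦x, y⟧ <> 0).
Proof.
have key (f : P -> P -> P) :
    linear_span [set f x y | x in setT & y in setT]%classic <> [set 0]%classic
    <-> exists x y, f x y <> 0.
  rewrite linear_span_eq0; split=> [|[x [y fxy]] sub0].
    apply: contra_notP => /forallNP f0 _ [x _ [y _ <-]].
    by move/forallNP: (f0 x) => /(_ y) /contrapT.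
  by apply: fxy; apply: sub0; exists x => //; exists y.
by rewrite /mixed !key.
Qed.

End Calculus.

(** * Subalgebras attached to an element *)

Section Dedekind.
Variables (F : fieldType) (P : poissonType F).
Hypothesis dedP : dedekind P.
Implicit Types (p x y z e : P).

(** Used both for elements of square zero and for idempotents. *)
Lemma dedekind_line t a : t ** t = a *: t ->
  forall p, (exists b, p ** t = b *: t) /\ (exists b, ⟦p, t⟧ = b *: t).
Proof.
move=> tt p; pose S : set P := fun z => exists b, z = b *: t.
have SS : subspace S.
  apply/subspaceP; split; first by exists 0; rewrite scale0r.
  by move=> b _ _ [c ->] [d ->]; exists (b * c + d); rewrite scalerDl scalerA.
have [|_ Sm Sb] := @dedP S _.
  split=> // _ _ [b ->] [c ->].
    by rewrite pmulZl pmulZr tt !scalerA; eexists.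
  by exists 0; rewrite pbracketZl pbracketZr pbracketxx !scaler0 scale0r.
by split; [apply: Sm | apply: Sb]; exists 1; rewrite scale1r.
Qed.

(** The vectors on the right-hand sides form a subalgebra containing [t]: the
    part [R] beyond [t] absorbs products with everything, and absorbs brackets
    with itself and with [t] because [[t, t ^ 2] = 0]. Allowing an arbitrary [y] in place of
    a power of [t] avoids computing with polynomials in [t]. *)
Lemma dedekind_tail t p :
  (exists a b y, p ** t = a *: t + (b *: (t ** t) + t ** t ** y)) /\
  (exists a b y, ⟦p, t⟧ = a *: t + (b *: (t ** t) + t ** t ** y)).
Proof.
pose R : set P := fun z => exists b y, z = b *: (t ** t) + t ** t ** y.
pose S : set P := fun z => exists a r, R r /\ z = a *: t + r.
have R0 : R 0 by exists 0, 0; rewrite scale0r pmul0r addr0.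
have RD b r s : R r -> R s -> R (b *: r + s).
  move=> [c [y ->]] [d [z ->]]; exists (b * c + d), (b *: y + z).
  by rewrite scalerDr scalerDl scalerA pmulZDr addrACA.
have Rt : R (t ** t) by exists 1, 0; rewrite scale1r pmul0r addr0.
have Rm r q : R r -> R (r ** q).
  move=> [b [y ->]]; exists 0, (b *: q + y ** q).
  by rewrite scale0r add0r pmulZDr pmulDl pmulZl !pmulA.
have RmC r q : R r -> R (q ** r) by rewrite pmulC; exact: Rm.
have RDD r s : R r -> R s -> R (r + s) by rewrite -{2}[r]scale1r; exact: RD.
have RN r : R r -> R (- r).
  by move=> Rr; rewrite -[- r]addr0 -scaleN1r; exact: RD.
have Rtb r : R r -> R ⟦t, r⟧.
  move=> [b [y ->]]; rewrite pbracketZDr !pbracketMr !pbracketxx !pmul0r.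
  by rewrite addr0 scaler0 pmul0r addr0 add0r; apply: Rm.
have Rb r s : R r -> R s -> R ⟦r, s⟧.
  move=> [b [y ->]] Rs; rewrite pbracketZDl !pbracket_leibniz.
  have Rtt : R (t ** ⟦t, s⟧ + t ** ⟦t, s⟧) by apply: RDD; exact/RmC/Rtb.
  by apply: RD => //; apply: RDD; [exact: Rm | exact: RmC].
have SS : subspace S.
  apply/subspaceP; split; first by exists 0, 0; rewrite scale0r addr0.
  move=> b _ _ [c [r [Rr ->]]] [d [s [Rs ->]]].
  exists (b * c + d), (b *: r + s); split; first exact: RD.
  by rewrite scalerDr scalerDl scalerA addrACA.
have [|_ Sm Sb] := @dedP S _.
  split=> // _ _ [c [r [Rr ->]]] [d [s [Rs ->]]].
    exists 0; eexists; split; last by rewrite scale0r add0r.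
    rewrite pmulZDr; apply: (RD); last exact: RmC.
    by rewrite pmulDl pmulZl; apply: RD; [exact: Rt | exact: Rm].
  exists 0; eexists; split; last by rewrite scale0r add0r.
  rewrite pbracketZDr pbracketDl pbracketZl pbracketxx scaler0 add0r.
  apply: (RD); first by rewrite pbracketC; apply: RN; exact: Rtb.
  by rewrite pbracketZDl; apply: RD; [exact: Rtb | exact: Rb].
have St : S t by exists 1, 0; rewrite scale1r addr0.
have [a [_ [[b [y ->]] pt]]] := Sm p t St.
have [c [_ [[d [z ->]] pbt]]] := Sb p t St.
by split; [exists a, b, y | exists c, d, z].
Qed.

(** Apply the previous lemma to [x] and [t = x ^ 2]: [x ^ 3] is
    [a x^2 + x^4 (b + y)]. Whether or not [a] vanishes, this gives a multiple
    [w = (c + y) x] of [x] with [x^3 w = x^3]. Then [e = w ^ 3] is a multiple of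
    [x ^ 3], which [e] fixes, so that [e e = e]. *)
Lemma cube_absorbs_idempotent x :
  exists2 e, e ** e = e & x ** x ** x ** e = x ** x ** x.
Proof.
(* [m c y] is multiplication by the formal element [c + y] of the unitization. *)
pose m (c : F) y z := c *: z + y ** z.
have mM c y u v : u ** m c y v = m c y (u ** v).
  by rewrite /m pmulZDr pmulCA.
(* When [a] is invertible, solve the relation for [x ^ 2] instead: then
   [x ^ 2] times [(x - (b + y) x ^ 2) / a] is [x ^ 2]. *)
have [c [y cube_m]] : exists c y, x ** x ** x ** m c y x = x ** x ** x.
  have [[a [b [y cube]]] _] := dedekind_tail (x ** x) x.
  have mE u : b *: u + u ** y = m b y u by rewrite /m (pmulC u).
  rewrite mE pmulA in cube; have [a0|a0] := eqVneq a 0.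
    exists b, y; rewrite mM {2}cube a0 scale0r add0r.
    by rewrite -!pmulA.
  exists a^-1, (- a^-1 *: m b y x).
  suff sqr_w : x ** x ** m a^-1 (- a^-1 *: m b y x) x = x ** x.
    by rewrite -!pmulA in sqr_w *; rewrite sqr_w.
  have gx : m b y x ** (x ** x ** x) = m b y (x ** x ** (x ** x)).
    by rewrite pmulC mM pmulA.
  rewrite mM {1}/m pmulZl gx scaleNr -scalerBr {1}cube addrK.
  by rewrite scalerA mulVf // scale1r.
set g := m c y in cube_m; have gM u v : u ** g v = g (u ** v) by exact: mM.
set z := x ** x ** x in cube_m *; set e := g x ** g x ** g x.
have ze : z ** e = z by rewrite !pmulA !cube_m.
exists e => //; have eE : e = g (g (g z)).
  by rewrite /e gM (pmulC _ x) !gM (pmulC _ x) !gM pmulA.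
by rewrite {2 3}eE !gM (pmulC e) ze.
Qed.

(** * Idempotents *)

(** [[p, e]] is a multiple of [e], hence fixed by [e], while the Leibniz rule on
    [e = e e] shows that it equals its double. *)
Lemma idempotent_central e p : e ** e = e -> ⟦p, e⟧ = 0.
Proof.
move=> ee; have [|_ [a pe]] := @dedekind_line e 1 _ p; first by rewrite scale1r.
apply: (@addIr _ ⟦p, e⟧).
by rewrite add0r -[in RHS]ee pbracketMr pe pmulZr ee.
Qed.

Lemma idempotent_mul e f : e ** e = e -> f ** f = f ->
  e ** f = 0 \/ e ** f = f.
Proof.
move=> ee ff; have [|[a ef] _] := @dedekind_line f 1 _ e; first by rewrite scale1r.
have : a *: (a *: f) = a *: f by rewrite -{1}ef -pmulZr -ef pmulA ee.
have [a0 _|a0 /(scalerI a0) aff] := eqVneq a 0; last by right; rewrite ef.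
by left; rewrite ef a0 scale0r.
Qed.

(** If [e f = 0] then [e + f] is again an idempotent, whose line is an ideal; but
    that ideal contains [e (e + f) = e], which is not on the line. Otherwise
    [e f] is equal to both [f] and [e]. *)
Lemma idempotent_unique e f : e ** e = e -> f ** f = f ->
  e <> 0 -> f <> 0 -> e = f.
Proof.
move=> ee ff e0 f0.
have [ef0|ef] := idempotent_mul ee ff; last first.
  have [fe0|<-] := idempotent_mul ff ee; last by rewrite pmulC ef.
  by case: f0; rewrite -ef pmulC.
have [|[a ea] _] := @dedekind_line (e + f) 1 _ e.
  by rewrite pmulDl !pmulDr ee ff (pmulC f) ef0 addr0 add0r scale1r.
rewrite pmulDr ee ef0 addr0 in ea.
have /eqP : a *: f = 0 by rewrite -{1}ff -[f ** f]add0r -{1}ef0 -pmulDl -pmulZl -ea.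
rewrite scaler_eq0 => /orP[/eqP a0|/eqP //].
by case: e0; rewrite ea a0 scale0r.
Qed.

(** Take [e] to be the non-zero idempotent if there is one, and [0] otherwise:
    the idempotent that fixes [y ^ 3] is [0] or [e], and both annihilate [y ^ 3]
    when [e y = 0]. *)
Lemma idempotent_nil_complement :
  exists2 e, e ** e = e & forall y, e ** y = 0 -> y ** y ** y = 0.
Proof.
have [[e [ee e0]]|noe] := pselect (exists e, e ** e = e /\ e <> 0).
  exists e => // y ey; have [f ff <-] := cube_absorbs_idempotent y.
  have [->|f0] := pselect (f = 0); first by rewrite pmul0r.
  rewrite (idempotent_unique ff ee f0 e0).
  by rewrite -pmulA (pmulC y e) ey pmul0r.
exists 0; rewrite ?pmul0r // => y _.
have [f ff <-] := cube_absorbs_idempotent y.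
have [->|f0] := pselect (f = 0); first by rewrite pmul0r.
by case: noe; exists f.
Qed.

(** * The nil part *)

Section NilPart.
Variable e : P.
Hypothesis nil_e : forall y, e ** y = 0 -> y ** y ** y = 0.

(** As [x ^ 3 = 0], the line of [x ^ 2] is an ideal, and the subalgebra of [x] is
    spanned by [x] and [x ^ 2], so [p x = a x + b x ^ 2] and
    [[p, x] = c x + d x ^ 2]. For [p x], if [x] and [a] were non-zero, [x] would
    be an eigenvector of multiplication by the nilpotent element [p - b x].
    For [[p, x]], bracketing once more with [p] gives [0], as [[p, x]] is also a
    combination of [p] and [p ^ 2]; this reads [c ([p, x] + 2 d x ^ 2) = 0], and
    either factor being zero puts [[p, x]] on the line of [x ^ 2]. *)
Lemma nil_square_line p x : e ** p = 0 -> e ** x = 0 ->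
  (exists b, p ** x = b *: (x ** x)) /\ (exists b, ⟦p, x⟧ = b *: (x ** x)).
Proof.
have tail q y : e ** y = 0 ->
    (exists a b, q ** y = a *: y + b *: (y ** y)) /\
    (exists a b, ⟦q, y⟧ = a *: y + b *: (y ** y)).
  move=> /nil_e y3; have y4 : y ** y ** (y ** y) = 0 *: (y ** y).
    by rewrite pmulA y3 pmul0l scale0r.
  have line z : exists c, y ** y ** z = c *: (y ** y).
    by rewrite pmulC; have [] := dedekind_line y4 z.
  have [[a [b [z ->]]] [c [d [w ->]]]] := dedekind_tail y q.
  have [[i ->] [j ->]] := (line z, line w).
  by rewrite -!scalerDl; split; do 2!eexists.
move=> ep ex; have x3 := nil_e ex.
have [[a [b px]] [c [d pbx]]] := tail p x ex.
have [c' [d' xbp]] := (tail x p ep).2.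
have px_line : p ** x = b *: (x ** x).
  pose q := - b *: x + p.
  have qx : q ** x = a *: x.
    by rewrite pmulDl pmulZl px scaleNr addrC addrK.
  have q3 : q ** q ** q = 0.
    by apply: nil_e; rewrite pmulZDr ep ex scaler0 addr0.
  have /eqP : (a * a * a) *: x = 0.
    by rewrite -(pmul0l x) -q3 -!pmulA !(qx, pmulZr) !scalerA.
  rewrite scaler_eq0 !mulf_eq0 !orbb => /orP[/eqP a0|/eqP ->].
    by rewrite px a0 scale0r add0r.
  by rewrite !pmul0r scaler0.
split; first by exists b.
have [c0|c0] := eqVneq c 0; first by exists d; rewrite pbx c0 scale0r add0r.
have pb2 : ⟦p, ⟦p, x⟧⟧ = 0.
  rewrite (pbracketC p x) xbp -scaleN1r !(pbracketZr, pbracketDr).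
  by rewrite pbracketMr !pbracketxx pmul0r !(addr0, scaler0).
have xpb : x ** ⟦p, x⟧ = c *: (x ** x).
  by rewrite pbx pmulDr !pmulZr pmulA x3 scaler0 addr0.
have pb_line : ⟦p, x⟧ = - (d + d) *: (x ** x).
  apply: (scalerI c0); apply/eqP; rewrite -subr_eq0 -pb2 {2}pbx.
  rewrite pbracketDr !pbracketZr pbracketMr xpb scaleNr scalerN opprK.
  by rewrite -scalerDl !scalerA !mulrDr (mulrC d).
by exists (- (d + d)).
Qed.

End NilPart.

(** * Vanishing of the bracket over square-closed fields *)

(** Subtracting their components on the idempotent changes no bracket, so it is
    enough to treat [p] and [x] annihilated by the idempotent. *)
Lemma dedekind_abelian : perfect2 F -> forall p x, ⟦p, x⟧ = 0.
Proof.
move=> sqrtF.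
have [e ee nil_e] := idempotent_nil_complement.
have nil_abelian p x : e ** p = 0 -> e ** x = 0 -> ⟦p, x⟧ = 0.
  move=> ep ex; set u := ⟦p, x⟧.
  have [u0|/eqP u0] := pselect (u = 0); first by [].
  have [[b px] [c pbx]] := nil_square_line nil_e ep ex.
  have [_ [a xbp]] := nil_square_line nil_e ex ep.
  have a0 : a != 0.
    apply: contraNneq u0 => a0.
    by rewrite /u pbracketC xbp a0 scale0r oppr0.
  have c0 : c != 0.
    by apply: contraNneq u0 => c0; rewrite /u pbx c0 scale0r.
  pose A := - a^-1; pose C := c^-1; pose B := b * C.
  have A0 : A != 0 by rewrite oppr_eq0 invr_eq0.
  have xx : x ** x = C *: u by rewrite /u pbx scalerA mulVf // scale1r.
  have pp : p ** p = A *: u.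
    by rewrite /u pbracketC xbp scalerN scaleNr opprK scalerA mulVf // scale1r.
  have {}px : p ** x = B *: u by rewrite px xx scalerA.
  (* The square of [s p + t x] is the form [A s^2 + 2 B s t + C t^2] times [u];
     [q] is an isotropic vector read off from its discriminant. *)
  have [d d2] := sqrtF (B ^+ 2 - A * C).
  pose q := (d - B) *: p + A *: x.
  have qq : q ** q = 0.
    rewrite pmulDl !pmulZl !pmulDr !pmulZr (pmulC x) xx pp px !scalerDr !scalerA.
    rewrite -!scalerDl; rewrite (_ : _ + _ = A * (d ^+ 2 - (B ^+ 2 - A * C))).
      by rewrite d2 subrr mulr0 scale0r.
    by ring.
  have eq0 : e ** q = 0 by rewrite pmulDr !pmulZr ep ex !scaler0 addr0.
  have [_ [k pq]] := nil_square_line nil_e ep eq0.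
  move/eqP: pq; rewrite qq scaler0 pbracketDr !pbracketZr pbracketxx scaler0.
  by rewrite add0r scaler_eq0 (negPf A0) (negPf u0).
move=> p x.
have split y : exists c, e ** (y - c *: e) = 0.
  have [|[c ye] _] := @dedekind_line e 1 _ y; first by rewrite scale1r.
  by exists c; rewrite pmulDr pmulNr pmulZr ee pmulC ye subrr.
have [[c ep] [d ex]] := (split p, split x).
have := nil_abelian _ _ ep ex.
rewrite -!scaleNr pbracketDr !pbracketDl !pbracketZr !pbracketZl pbracketxx.
rewrite (pbracketC e) !(idempotent_central _ ee) oppr0.
by rewrite !scaler0 !addr0.
Qed.

End Dedekind.

(** * The algebra of an anisotropic binary form *)

(** The triple [(s, t, k)] stands for [s p + t x + k u]. The type is
    indexed by [c] so that each [c] gets its own Poisson structure. *)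
Definition anisotropic_algebra (F : fieldType) (c : F) : Type :=
  (F^o * F^o * F^o)%type.

Section Anisotropic.
Variables (F : fieldType) (c : F).
Local Notation V := (anisotropic_algebra c).

HB.instance Definition _ := GRing.Lmodule.on V.

Definition aniso_mul (v w : V) : V :=
  (0, 0, v.1.1 * w.1.1 - c * (v.1.2 * w.1.2)).
Definition aniso_bracket (v w : V) : V :=
  (0, 0, v.1.1 * w.1.2 - v.1.2 * w.1.1).

Fact aniso_mul_bilinear : bilinear_for *:%R *:%R aniso_mul.
Proof. by split=> w a u v; congr (_, _, _) => /=; rewrite /GRing.scale /=; ring. Qed.

Fact aniso_mulC : commutative aniso_mul.
Proof. by move=> v w; congr (_, _, _) => /=; ring. Qed.

Fact aniso_mulA : associative aniso_mul.
Proof. by move=> v w z; congr (_, _, _) => /=; ring. Qed.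

Fact aniso_bracket_bilinear : bilinear_for *:%R *:%R aniso_bracket.
Proof. by split=> w a u v; congr (_, _, _) => /=; rewrite /GRing.scale /=; ring. Qed.

Fact aniso_bracketxx v : aniso_bracket v v = 0.
Proof. by congr (_, _, _) => /=; ring. Qed.

Fact aniso_jacobi x y z :
  aniso_bracket x (aniso_bracket y z) + aniso_bracket y (aniso_bracket z x)
    + aniso_bracket z (aniso_bracket x y) = 0.
Proof. by congr (_, _, _) => /=; ring. Qed.

Fact aniso_leibniz x y z : aniso_bracket (aniso_mul x y) z =
  aniso_mul x (aniso_bracket y z) + aniso_mul y (aniso_bracket x z).
Proof. by congr (_, _, _) => /=; ring. Qed.

HB.instance Definition _ := Lmodule_isPoisson.Build F V
  aniso_mul_bilinear aniso_mulC aniso_mulA aniso_bracket_bilinear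
  aniso_bracketxx aniso_jacobi aniso_leibniz.

Lemma aniso_mixed : mixed (V : poissonType F).
Proof.
apply/mixedP; pose p : V := (1, 0, 0); pose x : V := (0, 1, 0).
split; [exists p, p | exists p, x] => -[/eqP];
  by rewrite !(mul0r, mulr0, mulr1, subr0) oner_eq0.
Qed.

(** A subalgebra with an element [v] off the line of [u] contains [u], since
    [v v] is [u] times a value [n] of the form, non-zero by anisotropy. A
    subalgebra inside that line is annihilated by both operations. *)
Lemma aniso_dedekind : ~ (exists b, b ^+ 2 = c) -> dedekind (V : poissonType F).
Proof.
move=> nsq S [SS Sm Sb]; have [S0 SD] := (subspaceP S).1 SS.
have axis (v : V) k : S v -> (v.1.1, v.1.2) <> (0, 0) -> S (0, 0, k).
  move=> Sv v0; pose n := v.1.1 * v.1.1 - c * (v.1.2 * v.1.2).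
  have n0 : n != 0.
    apply: contra_notN v0; rewrite subr_eq0 => /eqP n0.
    have [y0|y0] := eqVneq v.1.2 0.
      by move: n0; rewrite y0 !mulr0 => /eqP; rewrite mulf_eq0 orbb => /eqP ->.
    case: nsq; exists (v.1.1 / v.1.2).
    by rewrite expr2 mulf_div n0 mulfK ?mulf_neq0.
  have -> : (0, 0, k) = (k / n) *: pmul v v + 0 :> V.
    congr (_, _, _) => /=; rewrite ?scaler0 ?addr0 //.
    by rewrite /GRing.scale /= -/n divfK.
  by apply: SD => //; apply: Sm.
split=> // w v Sv; have [[v1 v2]|v0] := pselect ((v.1.1, v.1.2) = (0, 0)).
- rewrite (_ : pmul w v = 0) //.
  by congr (_, _, _) => /=; rewrite v1 v2 !mulr0 subr0.
- exact: axis v0.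
- rewrite (_ : pbracket w v = 0) //.
  by congr (_, _, _) => /=; rewrite v1 v2 !mulr0 subr0.
- exact: axis v0.
Qed.

End Anisotropic.

(** * The existence criterion *)

Lemma exists_mixed_dedekind (F : fieldType) :
  (exists P : poissonType F, mixed P /\ dedekind P) <-> ~ perfect2 F.
Proof.
split=> [[P [/mixedP [_ [p [x pbx]]] dedP]] sqrtF|].
  exact: (pbx (dedekind_abelian dedP sqrtF p x)).
move=> /existsNP [c nsq]; exists (anisotropic_algebra c).
split; [exact: aniso_mixed | exact: aniso_dedekind].
Qed.

Lemma exists_nonsquare (F : fieldType) :
  (exists a : F, nonsquare a) <-> ~ perfect2 F.
Proof.
split=> [[a [a0 nsq]] sqrtF|/existsNP [c nsq]].
  have [b b2] := sqrtF a; apply: nsq; exists b; split=> //.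
  by apply: contraNneq a0 => b0; rewrite -b2 b0 expr0n.
exists c; split; last by case=> b [_ cb]; apply: nsq; exists b.
by apply: contra_notN nsq => /eqP ->; exists 0; rewrite expr0n.
Qed.

Theorem theorem8p3 (F : fieldType) :
  (2%N \notin [pchar F] ->
    ((exists P : poissonType F, mixed P /\ dedekind P) <->
     (exists a : F, nonsquare a))) /\
  (2%N \in [pchar F] ->
    ((exists P : poissonType F, mixed P /\ dedekind P) <-> imperfect2 F)).
Proof.
by split=> _; rewrite ?exists_nonsquare exists_mixed_dedekind.
Qed.
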